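(* Let $m$ and $n$ be relatively prime positive integers such that each group of order $mn$ has a normal subgroup of order $m$. Let $(B,\cdot,\circ)$ be a skew brace of size $mn$ such that the normal subgroup of order $m$ of $(B,\cdot)$ is an abelian group. Then $B$ has a subbrace of size $n$.
   Context: A skew (left) brace is a set $B$ with two operations $\cdot$ and $\circ$ such that $(B,\cdot)$ (the additive group) and $(B,\circ)$ (the multiplicative group) are groups and $a\circ(b\cdot c)=(a\circ b)\cdot a^{-1}\cdot(a\circ c)$ for all $a,b,c\in B$, where $a^{-1}$ is the inverse of $a$ in $(B,\cdot)$. A subbrace of $B$ is a subset that is a subgroup of both $(B,\cdot)$ and $(B,\circ)$ (hence is itself a skew brace). *)

(* Defs.v *)
From HB Require Import structures.
From mathcomp Require Import all_boot all_order all_fingroup.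

Set Implicit Arguments.
Unset Strict Implicit.
Unset Printing Implicit Defensive.

Import GroupScope.

(* The ambient (multiplicatively written) group structure of B is the group   *)
(* (B, .), called the additive group of the skew brace; circ, circ1 and circV *)
(* are the product, the identity and the inverse of the multiplicative group. *)
HB.mixin Record Group_isSkewBrace B of monoid.Group B := {
  circ : B -> B -> B;
  circ1 : B;
  circV : B -> B;
  circA : associative circ;
  circ1x : left_id circ1 circ;
  circx1 : right_id circ1 circ;
  circVx : left_inverse circ1 circV circ;
  circxV : right_inverse circ1 circV circ;
  circMr : forall a b c : B, circ a (b * c) = circ a b * a^-1 * circ a c
}.

#[short(type="skewBraceType")]
HB.structure Definition SkewBrace := {B of Group_isSkewBrace B & monoid.Group B}.

#[short(type="finSkewBraceType")]
HB.structure Definition FinSkewBrace := {B of SkewBrace B & FinGroup B}.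

Definition circ_subgroup (B : finSkewBraceType) (S : {set B}) : Prop :=
  [/\ circ1 \in S,
      {in S &, forall x y, circ x y \in S}
    & {in S, forall x, circV x \in S}].

Definition subbrace (B : finSkewBraceType) (S : {set B}) : Prop :=
  group_set S /\ circ_subgroup S.

(* Main.v *)
(** Write [lam a b = a^-1 * (a o b)], so that [lam] is an action of [(B, o)] on
    [(B, .)] by automorphisms; the normal Hall subgroup [M] is invariant under
    it.  By Schur-Zassenhaus [(B, o)] has a subgroup [C] of order [n], and [M]
    has a complement [N] in [(B, .)].  Let [C] act on [B] by [b |-> c o b], and
    [M x M] by [b |-> x^-1 * b * y].  Both actions permute the left cosets of
    the complements of [M], the second one transitively because these
    complements are conjugate under [M]; moreover [C] normalises the image of
    [M x M].  Since [n] is coprime to [m], Glauberman's argument provides a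
    coset [W] of a complement that is stable under [C].  Then [W = C o y] for
    any [y] in [W], and the [o]-translate of [W] by the [o]-inverse of [y] is at once
    a [o]-conjugate of [C] and an additive subgroup. *)

Require Import Defs.
From mathcomp Require Import all_boot all_order all_fingroup all_solvable.

Set Implicit Arguments.
Unset Strict Implicit.
Unset Printing Implicit Defensive.

Import GroupScope.

Section SkewBraceTheory.

Variable B : finSkewBraceType.
Implicit Types a b c x y : B.

Definition lam a b : B := a^-1 * circ a b.

Lemma circE a b : circ a b = a * lam a b.
Proof. by rewrite /lam mulKVg. Qed.

Lemma lamM a : {in [set: B] &, {morph lam a : b c / b * c}}.
Proof. by move=> b c _ _; rewrite /lam circMr !mulgA. Qed.

Canonical lam_morphism a := Morphism (lamM a).

Lemma lam1 a : lam a 1 = 1. Proof. exact: morph1. Qed.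

Lemma circ_unit : circ1 = 1 :> B.
Proof. by have := circE circ1 (1 : B); rewrite lam1 circ1x mulg1. Qed.

Lemma circK a : cancel (circ a) (circ (circV a)).
Proof. by move=> b; rewrite circA circVx circ1x. Qed.

Lemma lam_inj a : injective (lam a).
Proof. by move=> b c; rewrite /lam => /mulgI /(can_inj (circK a)). Qed.

Lemma circM_lam a b c : circ a (b * c) = circ a b * lam a c.
Proof. by rewrite circMr /lam !mulgA. Qed.

Lemma injm_lam a : 'injm (lam a).
Proof. by apply/injmP=> b c _ _ /lam_inj. Qed.

(** A normal Hall subgroup consists of all elements whose order involves only the primes of [#|M|],
    and an endomorphism preserves this property. *)
Lemma lam_normal_Hall (M : {group B}) a x :
  Hall [set: B] M -> M <| [set: B] -> x \in M -> lam a x \in M.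
Proof.
move=> /Hall_pi hallM nM Mx.
rewrite (mem_normal_Hall hallM nM) ?inE //.
by apply: morph_p_elt; rewrite ?inE // (mem_p_elt (pgroup_pi M)).
Qed.

Definition cperm a : {perm B} := perm (can_inj (circK a)).

Lemma cpermE a b : cperm a b = circ a b. Proof. exact: permE. Qed.

Lemma cpermM a b : cperm a * cperm b = cperm (circ b a).
Proof. by apply/permP=> c; rewrite permM !cpermE circA. Qed.

Lemma cperm_inj : injective cperm.
Proof. by move=> a b /permP/(_ circ1); rewrite !cpermE !circx1. Qed.

Lemma cperm1 : cperm circ1 = 1.
Proof. by apply/permP=> c; rewrite cpermE circ1x perm1. Qed.

Lemma cpermV a : (cperm a)^-1 = cperm (circV a).
Proof.
by apply: (mulgI (cperm a)); rewrite mulgV cpermM circVx cperm1.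
Qed.

(** This turns [(B, o)] into a [{group _}]. Permutations compose from left to right, so [cperm]
    reverses products and the image is a copy of the opposite group, which has the same
    subgroups. *)
Definition cperm_set := [set cperm a | a in [set: B]].

Lemma cperm_set_group_set : group_set cperm_set.
Proof.
apply/group_setP; split=> [|_ _ /imsetP[a _ ->] /imsetP[b _ ->]].
  by apply/imsetP; exists circ1; rewrite ?inE ?cperm1.
by rewrite cpermM imset_f ?inE.
Qed.

Canonical cperm_group := Group cperm_set_group_set.

Lemma card_cperm_group : #|cperm_group| = #|B|.
Proof. by rewrite card_imset ?cardsT //; apply: cperm_inj. Qed.

Lemma btrans_inj (p : B * B) : injective (fun b => p.1^-1 * b * p.2).
Proof. by move=> b c /mulIg/mulgI. Qed.

Definition btrans (p : B * B) : {perm B} := perm (@btrans_inj p).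

Lemma btransE p b : btrans p b = p.1^-1 * b * p.2.
Proof. exact: permE. Qed.

Lemma btransM : {in [set: B * B] &, {morph btrans : p q / p * q}}.
Proof.
by move=> p q _ _; apply/permP=> b; rewrite permM !btransE invMg !mulgA.
Qed.

Canonical btrans_morphism := Morphism btransM.

Definition btrans_group (M : {group B}) := (btrans @* setX_group M M)%G.

Lemma mem_btrans_group (M : {group B}) x y :
  x \in M -> y \in M -> btrans (x, y) \in btrans_group M.
Proof. by move=> Mx My; rewrite mem_morphim ?inE //=; apply/andP. Qed.

Lemma btrans_groupP (M : {group B}) s :
  s \in btrans_group M -> exists x y, [/\ x \in M, y \in M & s = btrans (x, y)].
Proof.
case/morphimP=> -[x y] _; rewrite inE /= => /andP[Mx My] ->.
by exists x, y.
Qed.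

Lemma btrans_group_abelian (M : {group B}) :
  abelian M -> abelian (btrans_group M).
Proof.
move=> /centsP cMM; apply: morphim_abelian; apply/centsP=> -[x y] + [z t].
rewrite !inE /= => /andP[Mx My] /andP[Mz Mt].
by congr pair; apply: cMM.
Qed.

(** Equality can fail, since a pair [(z, z)] with [z] central in [B] acts trivially; divisibility
    suffices for coprimality to [n]. *)
Lemma card_btrans_group (M : {group B}) : #|btrans_group M| %| #|M| * #|M|.
Proof. by rewrite -cardsX dvdn_morphim. Qed.

(** Pushing [a o _] through [x^-1 * b * y] turns [y] into [lam a y], and [x] into [lam a x]
    conjugated by [a^-1], because [a o x^-1 = a * (lam a x)^-1]. *)
Lemma cperm_group_norm_btrans (M : {group B}) :
  M <| [set: B] -> (forall a x, x \in M -> lam a x \in M) ->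
  cperm_group \subset 'N(btrans_group M).
Proof.
move=> /andP[_ nM] lamMM; apply/normsP=> _ /imsetP[a _ ->]; apply/eqP.
rewrite eqEcard cardJg leqnn andbT; apply/subsetP=> _ /imsetP[s Ls ->].
have{Ls} [x [y [Mx My ->]]] := btrans_groupP Ls.
suff ->: btrans (x, y) ^ cperm a = btrans (lam a x ^ a^-1, lam a y).
  apply: mem_btrans_group; rewrite ?lamMM // memJ_norm ?lamMM //.
  by rewrite (subsetP nM) ?inE.
rewrite conjgE; apply: (mulgI (cperm a)); rewrite mulKVg.
apply/permP=> b; rewrite !permM !btransE !cpermE /= !circM_lam.
rewrite circE (morphV (lam_morphism a)) ?inE //= !circE.
by rewrite conjgE invgK !invMg invgK !mulgA mulgKV.
Qed.

End SkewBraceTheory.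

(* Glauberman's lemma, read with [H] the stabiliser in [L * A] of a point of a
   set on which [L] acts transitively: [A] then fixes a point. *)
Lemma coprime_stab_conj (gT : finGroupType) (L A H : {group gT}) :
    solvable L -> A \subset 'N(L) -> coprime #|L| #|A| ->
    H \subset L * A -> A \subset L * H ->
  exists2 x, x \in L & A :^ x \subset H.
Proof.
move=> solL nLA coLA sHLA sALH.
have nLH: H \subset 'N(L).
  by rewrite (subset_trans sHLA) // mul_subG ?normG.
have eqD: L * H = L * A.
  apply/eqP; rewrite eqEsubset; apply/andP; split.
    by apply: subset_trans (mulgS L sHLA) _; rewrite mulgA mulGid.
  by apply: subset_trans (mulgS L sALH) _; rewrite mulgA mulGid.
have idx: #|H : L :&: H| = #|A|.
  have := congr1 (fun X : {set gT} => #|X|) eqD.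
  rewrite (coprime_cardMg coLA) => cLH.
  have := mul_cardG L H; rewrite cLH -(Lagrange (subsetIr L H)) -mulnA => /eqP.
  by rewrite eqn_pmul2l ?cardG_gt0 // mulnC eqn_pmul2r ?cardG_gt0 // => /eqP.
(* A complement of [L :&: H] in [H] has the order of [A] and lies in [L * A], hence is conjugate to
   [A] under the solvable group [L]. *)
have hallLH: Hall H (L :&: H).
  rewrite /Hall subsetIr idx /=.
  exact: coprime_dvdl (cardSg (subsetIl L H)) coLA.
have nsLH: L :&: H <| H by rewrite /normal subsetIr normsI ?normG.
have /splitsP[K /complP[tiK defH]] := SchurZassenhaus_split hallLH nsLH.
have cardK: #|K| = #|A|.
  apply/eqP; rewrite -idx -(eqn_pmul2l (cardG_gt0 (L :&: H))).
  by rewrite -TI_cardMg // defH Lagrange ?subsetIr.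
have sKH: K \subset H by rewrite -defH mulG_subr.
have [x Lx defK] := SchurZassenhaus_trans_sol solL nLA
                      (subset_trans sKH sHLA) coLA cardK.
by exists x; rewrite // -defK.
Qed.

Theorem proposition4 (m n : nat) (m_gt0 : (0 < m)%N) (n_gt0 : (0 < n)%N)
    (co_mn : coprime m n)
    (normal_m : forall (gT : finGroupType) (G : {group gT}),
       #|G| = (m * n)%N -> exists2 H : {group gT}, H <| G & #|H| = m)
    (B : finSkewBraceType) (cardB : #|B| = (m * n)%N)
    (M : {group B}) (nM : M <| [set: B]) (cardM : #|M| = m) (abM : abelian M) :
  exists2 S : {set B}, subbrace S & #|S| = n.
Proof.
have normal_m_compl (gT : finGroupType) (G H : {group gT}) :
    #|G| = (m * n)%N -> H <| G -> #|H| = m ->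
  exists K : {group gT}, [/\ H :&: K = 1, H * K = G & #|K| = n].
  move=> cG nHG cH; have sHG := normal_sub nHG.
  have idx: #|G : H| = n by rewrite -divgS // cG cH mulKn.
  have hallH: Hall G H by rewrite /Hall sHG cH idx.
  have /splitsP[K /complP[tiK defG]] := SchurZassenhaus_split hallH nHG.
  exists K; split=> //; apply/eqP.
  by rewrite -(eqn_pmul2l m_gt0) -{1}cH -TI_cardMg // defG cG.
have cardBT: #|[set: B]| = (m * n)%N by rewrite cardsT.
have hallM: Hall [set: B] M.
  by rewrite /Hall subsetT -divgS ?subsetT //= cardBT cardM mulKn.
have lamMM a x : x \in M -> lam a x \in M by apply: lam_normal_Hall.
have [N [tiN defB cardN]] := normal_m_compl _ [set: B]%G M cardBT nM cardM.
have cardR: #|cperm_group B| = (m * n)%N by rewrite card_cperm_group.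
(* Applied to the multiplicative group, the hypothesis on groups of order [m * n] yields a subgroup
   [A] of order [n], the image of [C]. *)
have [K nK cardK] := normal_m _ _ cardR.
have [A [_ defR cardA]] := normal_m_compl _ _ _ cardR nK cardK.
have sAR: A \subset cperm_group B by rewrite -defR mulG_subr.
pose L := btrans_group M.
have nLA: A \subset 'N(L).
  exact: subset_trans sAR (cperm_group_norm_btrans nM lamMM).
have coLA: coprime #|L| #|A|.
  rewrite cardA (coprime_dvdl (card_btrans_group M)) //.
  by rewrite coprimeMl cardM co_mn.
have nMN: N \subset 'N(M) by rewrite (subset_trans (subsetT N)) ?normal_norm.
have coMN: coprime #|M| #|N| by rewrite cardM cardN.
have solM := abelian_sol abM.
(* Write [a = x * z] with [x] in [M] and [z] in [N]; complements being conjugate, [lam a] maps [N]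
   onto [N :^ y] with [y] in [M]. As [z * N = N], this gives [a o N = x * z * y^-1 * N * y = (x * (z
   * y^-1 * z^-1)) * N * y]. *)
have AN s : s \in A -> exists2 t, t \in L & s @: N = t @: N.
  move=> /(subsetP sAR)/imsetP[a _ ->].
  have sNaMN: lam a @* N \subset M * N by rewrite defB subsetT.
  have cNa: #|lam a @* N| = #|N| by rewrite card_injm ?injm_lam ?subsetT.
  have [y My defNa] := SchurZassenhaus_trans_sol solM nMN sNaMN coMN cNa.
  have /mulsgP[x z Mx Nz defa]: a \in M * N by rewrite defB inE.
  have My': y^-1 ^ z^-1 \in M.
    by rewrite memJ_norm ?groupV // (subsetP nMN) ?groupV.
  exists (btrans ((x * y^-1 ^ z^-1)^-1, y)).
    by apply: mem_btrans_group; rewrite /= ?groupV ?(groupMl _ Mx).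
  apply/eqP; rewrite eqEcard !card_imset ?leqnn ?andbT; try exact: perm_inj.
  apply/subsetP=> _ /imsetP[b Nb ->]; rewrite cpermE circE.
  have: lam a b \in N :^ y by rewrite -defNa mem_morphim ?inE.
  case/imsetP=> u Nu ->; apply/imsetP; exists (z * u); first exact: groupM.
  by rewrite btransE /= invgK defa !conjgE invgK !mulgA mulgKV.
pose H := ('N_(L <*> A)(N | 'P))%G.
have defLA: L <*> A = L * A by rewrite norm_joinEr.
have [t Lt sAtH]: exists2 t, t \in L & A :^ t \subset H.
  apply: coprime_stab_conj nLA coLA _ _.
  - exact/abelian_sol/btrans_group_abelian.
  - by rewrite -defLA subsetIl.
  (* The inverse is taken because [t * s] applies [t] first: from [t @: N = s^-1 @: N] it follows
     that [t * s] stabilises [N]. *)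
  apply/subsetP=> s As; have [t Lt sNt] := AN s^-1 (groupVr As).
  apply/mulsgP; exists t^-1 (t * s); rewrite ?groupV ?mulKg //.
  apply/setIP; split; first by rewrite groupM ?mem_gen ?inE ?Lt ?As ?orbT.
  apply/astabsP=> b; rewrite /= /aperm permM.
  rewrite -(mem_imset _ _ (@perm_inj _ s^-1)) permK sNt mem_imset //.
  exact: perm_inj.
pose W := t^-1 @: N.
have AW s w : s \in A -> w \in W -> s w \in W.
  move=> As /imsetP[z Nz ->].
  have /setIP[_ /astabsP/(_ z)]: s ^ t \in H.
    by rewrite (subsetP sAtH) ?memJ_conjg.
  rewrite /= /aperm conjgE !permM Nz => Nz'; apply/imsetP.
  by exists (t (s (t^-1 z))); rewrite ?permK.
have [x [y [Mx My def_t]]] := btrans_groupP (groupVr Lt).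
pose w0 := t^-1 1; have Ww0: w0 \in W by rewrite imset_f.
(* [A] acts freely on [B] and [W] has [n] elements, so the stable set [W] is a single orbit of
   [A]. *)
have defW: W = [set s w0 | s : {perm B} in A].
  apply/eqP; rewrite eq_sym eqEcard; apply/andP; split.
    by apply/subsetP=> _ /imsetP[s As ->]; apply: AW.
  rewrite card_imset ?cardN -?cardA; last exact: perm_inj.
  rewrite card_in_imset // => r s /(subsetP sAR)/imsetP[a _ ->].
  move=> /(subsetP sAR)/imsetP[b _ ->]; rewrite !cpermE => eq_ab.
  congr cperm; rewrite -[a]circx1 -[b]circx1 -(circxV w0).
  by rewrite !circA eq_ab.
pose S := [set circ (circV w0) w | w in W].
(* [W] is the left coset [w0 * N :^ y], and the [o]-inverse of [w0] sends [w0 * u] to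
   [lam (circV w0) u]; hence [S] is an additive subgroup. *)
have defS: S = lam (circV w0) @* (N :^ y).
  apply/eqP; rewrite eqEcard card_injm ?injm_lam ?subsetT // cardJg.
  rewrite !card_imset ?leqnn ?andbT; try exact: perm_inj; last first.
    exact: can_inj (circK _).
  apply/subsetP=> _ /imsetP[_ /imsetP[z Nz ->] ->].
  have ->: t^-1 z = w0 * z ^ y.
    by rewrite /w0 def_t !btransE /= conjgE mulg1 !mulgA mulgK.
  by rewrite circM_lam circVx circ_unit mul1g mem_morphim ?inE ?memJ_conjg.
(* Since [W = C o w0], the set [S] is the conjugate of [C] by [w0] in [(B, o)]. *)
have SP a : (a \in S) = (cperm (circ w0 (circ a (circV w0))) \in A).
  apply/imsetP/idP=> [[w + ->]|Aa].
    rewrite defW => /imsetP[s As ->].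
    have /imsetP[c _ def_s] := subsetP sAR _ As; rewrite def_s in As *.
    by rewrite cpermE !circA circxV circ1x -circA circxV circx1.
  exists (circ w0 a); last by rewrite circK.
  rewrite defW; apply/imsetP; exists (cperm (circ w0 (circ a (circV w0)))) => //.
  by rewrite cpermE -!circA circVx circx1.
exists S; last first.
  by rewrite defS card_injm ?injm_lam ?subsetT // cardJg.
split; first by rewrite defS groupP.
split=> [|a b|a]; rewrite ?SP.
- by rewrite circ1x circxV cperm1 group1.
- move=> Aa Ab; have := groupM Ab Aa; rewrite cpermM.
  by rewrite !circA -(circA _ _ w0) circVx circx1.
move=> Aa; have := groupVr Aa; rewrite cpermV.
congr (cperm _ \in A).
apply: (can_inj (circK (circ w0 (circ a (circV w0))))); rewrite circxV.
by rewrite -!circA (circA (circV w0)) circVx circ1x (circA a) circxV circ1x circxV.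
Qed.
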